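(* Let $D\subset\mathbb{C}^n$ be invariant with respect to complex conjugation. For every $H\in\mathcal{P}(n)$, $$\mathcal{S}_{c,H}(\Omega_D)=\Big\{\mathcal{I}(F): F\in Stem(D),\ F=\sum_{K\subset H^c}e_KF_K\Big\}.$$ In particular, $\mathcal{S}_{c,H}(\Omega_D)\subset\mathcal{S}_H(\Omega_D)$.
   Context: $\mathbb{H}$ is the algebra of quaternions, $\mathbb{S}_{\mathbb{H}}=\{q\in\mathbb{H}: q^2=-1\}$. $n\ge1$; $\mathcal{P}(n)$ is the set of subsets of $\{1,\dots,n\}$; $H^c=\{1,\dots,n\}\setminus H$. For $K=\{k_1<\dots<k_p\}\in\mathcal{P}(n)$ and quaternions $q_{k_1},\dots,q_{k_p}$, put $q_K=q_{k_1}\cdots q_{k_p}$ ($q_\emptyset=1$), and $[q_K,a]=q_K\,a$ for $a\in\mathbb{H}$. For $z\in\mathbb{C}^n$, $\overline{z}^h$ is $z$ with its $h$-th coordinate conjugated. $D\subset\mathbb{C}^n$ is invariant with respect to complex conjugation if $z\in D\iff\overline{z}^h\in D$ for every $h$. Its circularization is $\Omega_D=\{(\alpha_l+J_l\beta_l)_{l=1}^n: (\alpha_l+i\beta_l)_{l=1}^n\in D,\ J_1,\dots,J_n\in\mathbb{S}_{\mathbb{H}}\}\subset\mathbb{H}^n$. Let $\{e_K\}_{K\in\mathcal{P}(n)}$ be a basis of $\mathbb{R}^{2^n}$. A stem function is $F=\sum_{K}e_KF_K:D\to\mathbb{H}\otimes\mathbb{R}^{2^n}$, $F_K:D\to\mathbb{H}$,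 with $F_K(\overline{z}^h)=(-1)^{|K\cap\{h\}|}F_K(z)$ for all $K,h,z$; $Stem(D)$ is the set of these. $F$ induces the slice function $f=\mathcal{I}(F):\Omega_D\to\mathbb{H}$, $f(x)=\sum_K[J_K,F_K(z)]$ for $x=(\alpha_l+J_l\beta_l)_l$, $z=(\alpha_l+i\beta_l)_l\in D$. $\mathcal{S}(\Omega_D)$ is the set of slice functions; each slice function is induced by a unique stem function. One variable: for $E\subset\mathbb{C}$ conjugation invariant and $\Omega_E=\{\alpha+J\beta:\alpha+i\beta\in E, J\in\mathbb{S}_{\mathbb{H}}\}$, a function $g:\Omega_E\to\mathbb{H}$ is slice if $g(\alpha+J\beta)=G_1(\alpha+i\beta)+J\,G_2(\alpha+i\beta)$ for functions $G_1,G_2:E\to\mathbb{H}$ with $G_1(\overline w)=G_1(w)$, $G_2(\overline w)=-G_2(w)$. For $y\in\Omega_D$ let $\Omega_{D,h}(y)=\{x\in\mathbb{H}:(y_1,\dots,y_{h-1},x,y_{h+1},\dots,y_n)\in\Omega_D\}$ (a set of the form $\Omega_E$) and $f^y_h:\Omega_{D,h}(y)\to\mathbb{H}$, $f^y_h(x)=f(y_1,\dots,y_{h-1},x,y_{h+1},\dots,y_n)$. $\mathcal{S}_h(\Omega_D)$ is the set of $f\in\mathcal{S}(\Omega_D)$ such that $f^y_h$ is a one-variable slice function for every $y\in\Omega_D$. $\mathcal{S}_{c,h}(\Omega_D)$ (functions circular w.r.t. $x_h$) is the set of $f\in\mathcal{S}(\Omega_D)$ such that for every $y\in\Omega_D$,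 $f^y_h$ is constant on the sphere $\mathbb{S}_{y_h}=\{\alpha+I\beta: I\in\mathbb{S}_{\mathbb{H}}\}$, where $y_h=\alpha+J\beta$ with $\alpha,\beta\in\mathbb{R}$, $J\in\mathbb{S}_{\mathbb{H}}$. $\mathcal{S}_H(\Omega_D)=\bigcap_{h\in H}\mathcal{S}_h(\Omega_D)$ and $\mathcal{S}_{c,H}(\Omega_D)=\bigcap_{h\in H}\mathcal{S}_{c,h}(\Omega_D)$ (both understood as $\mathcal{S}(\Omega_D)$ if $H=\emptyset$). *)

(* Defs.v *)
From HB Require Import structures.
From mathcomp Require Import all_boot all_order all_algebra ring lra.
From mathcomp Require Import boolp classical_sets reals.
From mathcomp Require Import complex.

Set Implicit Arguments.
Unset Strict Implicit.
Unset Printing Implicit Defensive.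

Import Order.TTheory GRing.Theory Num.Theory.

Local Open Scope classical_set_scope.
Local Open Scope ring_scope.

(* Quat a b c d is a + b i + c j + d k. *)
Record quat (R : Type) : Type :=
  Quat { qr : R; qi : R; qj : R; qk : R }.

Definition tuple_of_quat (R : Type) (q : quat R) : R * R * R * R :=
  (qr q, qi q, qj q, qk q).
Definition quat_of_tuple (R : Type) (t : R * R * R * R) : quat R :=
  let: (a, b, c, d) := t in Quat a b c d.

Lemma tuple_of_quatK (R : Type) :
  cancel (@tuple_of_quat R) (@quat_of_tuple R).
Proof. by case. Qed.

HB.instance Definition _ (R : choiceType) := Choice.copy (quat R)
  (can_type (@tuple_of_quatK R)).

Definition qzero (R : pzRingType) : quat R := Quat 0 0 0 0.
Definition qone (R : pzRingType) : quat R := Quat 1 0 0 0.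
Definition qadd (R : pzRingType) (p q : quat R) : quat R :=
  Quat (qr p + qr q) (qi p + qi q) (qj p + qj q) (qk p + qk q).
Definition qopp (R : pzRingType) (p : quat R) : quat R :=
  Quat (- qr p) (- qi p) (- qj p) (- qk p).
Definition qmul (R : pzRingType) (p q : quat R) : quat R :=
  Quat (qr p * qr q - qi p * qi q - qj p * qj q - qk p * qk q)
       (qr p * qi q + qi p * qr q + qj p * qk q - qk p * qj q)
       (qr p * qj q - qi p * qk q + qj p * qr q + qk p * qi q)
       (qr p * qk q + qi p * qj q - qj p * qi q + qk p * qr q).
Definition qscale (R : pzRingType) (a : R) (q : quat R) : quat R :=
  Quat (a * qr q) (a * qi q) (a * qj q) (a * qk q).

Lemma qaddA (R : comNzRingType) : associative (@qadd R).
Proof. by move=> p q r; rewrite /qadd /= !addrA. Qed.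
Lemma qaddC (R : comNzRingType) : commutative (@qadd R).
Proof. by move=> p q; congr Quat => /=; rewrite addrC. Qed.
Lemma qadd0 (R : comNzRingType) : left_id (@qzero R) (@qadd R).
Proof. by case=> a b c d; rewrite /qadd /= !add0r. Qed.
Lemma qaddN (R : comNzRingType) : left_inverse (@qzero R) (@qopp R) (@qadd R).
Proof. by move=> p; rewrite /qadd /= !addNr. Qed.

HB.instance Definition _ (R : comNzRingType) := GRing.isZmodule.Build (quat R)
  (@qaddA R) (@qaddC R) (@qadd0 R) (@qaddN R).

Lemma qmulA (R : comNzRingType) : associative (@qmul R).
Proof. by move=> p q r; congr Quat => /=; ring. Qed.
Lemma qmul1l (R : comNzRingType) : left_id (@qone R) (@qmul R).
Proof. by case=> a b c d; congr Quat => /=; ring. Qed.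
Lemma qmul1r (R : comNzRingType) : right_id (@qone R) (@qmul R).
Proof. by case=> a b c d; congr Quat => /=; ring. Qed.
Lemma qmulDl (R : comNzRingType) : left_distributive (@qmul R) (@qadd R).
Proof. by move=> p q r; congr Quat => /=; ring. Qed.
Lemma qmulDr (R : comNzRingType) : right_distributive (@qmul R) (@qadd R).
Proof. by move=> p q r; congr Quat => /=; ring. Qed.
Lemma qone_neq0 (R : comNzRingType) : @qone R != 0.
Proof. by apply/eqP => -[/eqP]; rewrite oner_eq0. Qed.

HB.instance Definition _ (R : comNzRingType) :=
  GRing.Zmodule_isNzRing.Build (quat R)
    (@qmulA R) (@qmul1l R) (@qmul1r R) (@qmulDl R) (@qmulDr R) (@qone_neq0 R).

Lemma qscaleA (R : comNzRingType) (a b : R) (q : quat R) :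
  qscale a (qscale b q) = qscale (a * b) q.
Proof. by rewrite /qscale /= !mulrA. Qed.
Lemma qscale1 (R : comNzRingType) : left_id 1 (@qscale R).
Proof. by case=> a b c d; rewrite /qscale /= !mul1r. Qed.
Lemma qscaleDr (R : comNzRingType) : right_distributive (@qscale R) +%R.
Proof. by move=> a p q; congr Quat => /=; rewrite mulrDr. Qed.
Lemma qscaleDl (R : comNzRingType) (q : quat R) :
  {morph (@qscale R)^~ q : a b / a + b}.
Proof. by move=> a b; congr Quat => /=; rewrite mulrDl. Qed.

HB.instance Definition _ (R : comNzRingType) :=
  GRing.Zmodule_isLmodule.Build R (quat R)
    (@qscaleA R) (@qscale1 R) (@qscaleDr R) (@qscaleDl R).

Lemma qscaleAl (R : comNzRingType) (a : R) (p q : quat R) :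
  a *: (p * q) = (a *: p) * q.
Proof. by congr Quat => /=; ring. Qed.
HB.instance Definition _ (R : comNzRingType) :=
  GRing.Lmodule_isLalgebra.Build R (quat R) (@qscaleAl R).

Lemma qscaleAr (R : comNzRingType) (a : R) (p q : quat R) :
  a *: (p * q) = p * (a *: q).
Proof. by congr Quat => /=; ring. Qed.
HB.instance Definition _ (R : comNzRingType) :=
  GRing.Lalgebra_isAlgebra.Build R (quat R) (@qscaleAr R).

Definition imag_units (R : realType) : set (quat R) := [set q | q ^+ 2 = -1].

(* \alpha + J \beta for w = \alpha + i \beta *)
Definition qpt (R : realType) (w : R[i]) (J : quat R) : quat R :=
  (complex.Re w)%:A + J * (complex.Im w)%:A.

(* The product over k \in K is taken in increasing order of k. *)
Definition qprod (R : realType) (n : nat) (q : 'I_n -> quat R)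
    (K : {set 'I_n}) : quat R :=
  \prod_(k in K) q k.

Definition conj_at (R : realType) (n : nat) (h : 'I_n) (z : 'rV[R[i]]_n) :
    'rV[R[i]]_n :=
  \row_l (if l == h then conjc (z 0 l) else z 0 l).

Definition conj_invariant (R : realType) (n : nat) (D : set 'rV[R[i]]_n) :=
  forall (h : 'I_n) (z : 'rV[R[i]]_n), D z <-> D (conj_at h z).

Definition circ_pt (R : realType) (n : nat) (z : 'rV[R[i]]_n)
    (J : 'I_n -> quat R) : 'rV[quat R]_n :=
  \row_l qpt (z 0 l) (J l).

Definition circ (R : realType) (n : nat) (D : set 'rV[R[i]]_n) :
    set 'rV[quat R]_n :=
  [set x | exists p : D * ('I_n -> quat R),
     (forall l, imag_units (p.2 l)) /\ x = circ_pt (val p.1) p.2].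

(* H \otimes R^(2^n) in coordinates along the basis (e_K): the component of
   index K of an element is its coefficient at e_K. *)
Definition tens (R : realType) (n : nat) := {ffun {set 'I_n} -> quat R}.

Definition e_ (R : realType) (n : nat) (K : {set 'I_n}) (a : quat R) :
    tens R n :=
  [ffun L => if L == K then a else 0].

Lemma tens_sum (R : realType) (n : nat) (t : tens R n) :
  t = \sum_(K : {set 'I_n}) e_ K (t K).
Proof.
apply/ffunP => L; rewrite sum_ffunE (bigD1 L) //= ffunE eqxx.
by rewrite big1 ?addr0 // => K KL; rewrite ffunE eq_sym (negbTE KL).
Qed.

Definition stem (R : realType) (n : nat) (D : set 'rV[R[i]]_n) :
    set (D -> tens R n) :=
  [set F | forall (K : {set 'I_n}) (h : 'I_n) (z w : D),
     val w = conj_at h (val z) -> F w K = (-1) ^+ #|K :&: [set h]| * F z K].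
Arguments stem {R n} D.

Lemma circ_repr (R : realType) (n : nat) (D : set 'rV[R[i]]_n) (x : circ D) :
  exists p : D * ('I_n -> quat R),
    (forall l, imag_units (p.2 l)) /\ val x = circ_pt (val p.1) p.2.
Proof. exact: set_mem (valP x). Qed.

(* I(F); the value does not depend on the chosen representation (z, J) of x
   when F is a stem function, see slice_ofE. *)
Definition slice_of (R : realType) (n : nat) (D : set 'rV[R[i]]_n)
    (F : D -> tens R n) : circ D -> quat R :=
  fun x => let: (z, J) := sval (cid (circ_repr x)) in
    \sum_(K : {set 'I_n}) qprod J K * F z K.

Lemma quatE (R : realType) (p q : quat R) :
  p = q <-> [/\ qr p = qr q, qi p = qi q, qj p = qj q & qk p = qk q].
Proof.
split=> [->//|]; case: p => a b c d; case: q => a' b' c' d' /=.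
by case=> -> -> -> ->.
Qed.

Lemma imag_unitsP (R : realType) (J : quat R) : imag_units J ->
  qr J = 0 /\ qi J ^+ 2 + qj J ^+ 2 + qk J ^+ 2 = 1.
Proof.
case: J => a b c d; rewrite /imag_units /= expr2 => /quatE[] /=.
rewrite !oppr0 => h1 h2 h3 h4.
have a0 : a = 0.
  apply/eqP; apply: contraT => a0.
  have z (x : R) : a * x = 0 -> x = 0.
    by move=> /eqP; rewrite mulf_eq0 (negbTE a0) => /eqP.
  have b0 : b = 0 by apply: z; lra.
  have c0 : c = 0 by apply: z; lra.
  have d0 : d = 0 by apply: z; lra.
  by move: h1; rewrite b0 c0 d0; nra.
by split=> //; move: h1; rewrite a0; lra.
Qed.

Lemma qpt_inj (R : realType) (w w' : R[i]) (J J' : quat R) :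
  imag_units J -> imag_units J' -> qpt w J = qpt w' J' ->
  [\/ w = w' /\ J = J', w' = conjc w /\ J' = - J | w = w' /\ w = conjc w].
Proof.
case: w w' => [a b] [a' b'] /imag_unitsP + /imag_unitsP.
case: J J' => [r i j k] [r' i' j' k'] /= [-> n1] [-> n2] /quatE[] /=.
rewrite !(mulr0, mul0r, mulr1, addr0, add0r, subr0, oppr0) => <- e1 e2 e3.
have : (b - b') * (b + b') = 0.
  have : b ^+ 2 = b' ^+ 2.
    rewrite -[b ^+ 2]mulr1 -n1 -[b' ^+ 2]mulr1 -n2 !mulrDr -!exprMn.
    by rewrite ![b * _]mulrC ![b' * _]mulrC e1 e2 e3.
  by move=> e; rewrite -subr_sqr e subrr.
have [b0|b0] := eqVneq b 0.
  rewrite b0 sub0r add0r => /eqP; rewrite mulf_eq0 oppr_eq0 orbb => /eqP ->.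
  by move=> *; apply: Or33; rewrite oppr0.
move=> /eqP; rewrite mulf_eq0 subr_eq0 addr_eq0 => /orP[]/eqP bb.
  apply: Or31; move: e1 e2 e3; rewrite bb => e1 e2 e3.
  have b'0 : b' != 0 by rewrite -bb.
  by rewrite (mulIf b'0 e1) (mulIf b'0 e2) (mulIf b'0 e3).
apply: Or32; have -> : b' = - b by rewrite bb opprK.
split=> //; move: e1 e2 e3; rewrite bb !mulrN => e1 e2 e3.
have b'0 : b' != 0 by rewrite -oppr_eq0 -bb.
apply/quatE; split=> /=; rewrite ?oppr0 //; apply: (mulIf b'0).
- by rewrite -e1 mulNr.
- by rewrite -e2 mulNr.
- by rewrite -e3 mulNr.
Qed.

Lemma circ_pt_flip (R : realType) (n : nat) (D : set 'rV[R[i]]_n)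
    (F : D -> tens R n) (h : 'I_n) (z z' : D) (J J' : 'I_n -> quat R) :
  stem D F -> (forall l, imag_units (J l)) -> (forall l, imag_units (J' l)) ->
  circ_pt (val z) J = circ_pt (val z') J' ->
  (forall l, l != h -> val z 0 l = val z' 0 l /\ J l = J' l) ->
  \sum_(K : {set 'I_n}) qprod J K * F z K =
  \sum_(K : {set 'I_n}) qprod J' K * F z' K.
Proof.
move=> Fs Ju J'u /rowP/(_ h); rewrite !mxE => /(qpt_inj (Ju h) (J'u h)) hh ol.
apply: eq_bigr => K _.
have prodE : h \notin K -> qprod J' K = qprod J K.
  move=> hK; apply: eq_bigr => k kK; rewrite (ol k _).2 //.
  by apply: contraNneq hK => <-.
have card1 : #|K :&: [set h]%SET| = (h \in K) :> nat.
  have [hK|hK] := boolP (h \in K).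
    by rewrite (finset.setIidPr _) ?cards1// finset.sub1set.
  by apply/eqP; rewrite cards_eq0 finset.setI_eq0 disjoint_sym disjoints1.
have eqz (w : D) : val w 0 h = val z' 0 h -> (forall l, l != h -> val w 0 l = val z' 0 l) -> w = z'.
  move=> e1 e2; apply: val_inj; apply/rowP => l.
  by have [->|/e2] := eqVneq l h.
have conjE : val z' 0 h = conjc (val z 0 h) -> val z' = conj_at h (val z).
  move=> e; apply/rowP => l; rewrite mxE; have [->//|lh] := eqVneq l h.
  by rewrite (ol l lh).1.
case: hh => [[e1 e2]|[e1 e2]|[e1 e2]].
- rewrite -(eqz z) // => [|l /ol[]//].
  congr (_ * _); apply: eq_bigr => k _.
  by have [->|/ol[]] := eqVneq k h.
- rewrite (Fs K h z z' (conjE e1)) card1.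
  have [hK|hK] := boolP (h \in K); last by rewrite mul1r prodE.
  rewrite expr1 mulN1r mulrN -mulNr; congr (_ * _); rewrite /qprod.
  rewrite -!(big_filter _ (mem K)).
  have : h \in [seq i <- index_enum 'I_n | i \in K] by rewrite mem_filter hK mem_index_enum.
  have : uniq [seq i <- index_enum 'I_n | i \in K] by rewrite filter_uniq // index_enum_uniq.
  move=> + hin; case/splitPr: hin => s1 s2.
  rewrite cat_uniq /= negb_or => /and4P[_ /andP[h1 _] h2 _].
  rewrite !big_cat !big_cons /= e2 mulNr mulrN opprK.
  have eqs (s : seq 'I_n) : h \notin s -> \prod_(i <- s) J i = \prod_(i <- s) J' i.
    move=> hs; apply: eq_big_seq => i iins; rewrite (ol i _).2 //.
    by apply: contraNneq hs => <-.
  by rewrite !eqs.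
- have zz' : z = z' by apply: eqz => // l /ol[].
  have [hK|hK] := boolP (h \in K); last by rewrite prodE // zz'.
  have := Fs K h z z; rewrite card1 hK mulN1r => /(_ _) F0.
  have {}F0 : F z K = - F z K.
    by apply: F0; rewrite {1}zz'; apply: conjE; rewrite -zz' -e2.
  rewrite -zz'; suff -> : F z K = 0 by rewrite !mulr0.
  by case/quatE: F0 => /= f1 f2 f3 f4; apply/quatE; split => /=; lra.
Qed.

Lemma slice_ofE (R : realType) (n : nat) (D : set 'rV[R[i]]_n)
    (F : D -> tens R n) (z : D) (J : 'I_n -> quat R) (x : circ D) :
  conj_invariant D -> stem D F -> (forall l, imag_units (J l)) ->
  val x = circ_pt (val z) J ->
  slice_of F x = \sum_(K : {set 'I_n}) qprod J K * F z K.
Proof.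
move=> Di Fs Ju; rewrite /slice_of; case: cid => -[z' J'] /= [J'u ->] e.
pose zm m := \row_l (if (l < m)%N then val z 0 l else val z' 0 l).
pose Jm m (l : 'I_n) := if (l < m)%N then J l else J' l.
have Jmu m l : imag_units (Jm m l) by rewrite /Jm; case: ifP.
have ptm m : circ_pt (zm m) (Jm m) = circ_pt (val z') J'.
  apply/rowP => l; rewrite !mxE /Jm; case: ifP => // _.
  by move/rowP: e => /(_ l); rewrite !mxE.
have zmS m (h : 'I_n) : h = m :> nat -> D (zm m) ->
    D (zm m.+1) /\ forall l, l != h -> zm m.+1 0 l = zm m 0 l /\ Jm m.+1 l = Jm m l.
  move=> hm Dm.
  have ol l : l != h -> (l < m.+1)%N = (l < m)%N.
    by move=> lh; rewrite ltnS leq_eqVlt -hm -[X in X || _]/(l == h) (negbTE lh).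
  split; last by move=> l /ol lm; rewrite !mxE /Jm lm.
  have zmh : zm m.+1 0 h = val z 0 h by rewrite mxE -hm ltnSn.
  have zmh' : zm m 0 h = val z' 0 h by rewrite mxE -hm ltnn.
  move/rowP: e => /(_ h); rewrite !mxE => /(qpt_inj (J'u h) (Ju h)) hh.
  have [same|conj] : zm m.+1 0 h = zm m 0 h \/ zm m.+1 0 h = conjc (zm m 0 h).
    by rewrite zmh zmh'; case: hh => [[-> _]|[-> _]|[-> _]]; [left|right|left].
  - suff -> : zm m.+1 = zm m by [].
    apply/rowP => l; have [->//|/ol lm] := eqVneq l h; by rewrite !mxE lm.
  - suff -> : zm m.+1 = conj_at h (zm m) by apply/(Di h _).1.
    apply/rowP => l; rewrite [RHS]mxE; have [->//|/ol lm] := eqVneq l h.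
    by rewrite !mxE lm.
have main m : (m <= n)%N -> exists w : D, val w = zm m /\
    \sum_(K : {set 'I_n}) qprod J' K * F z' K =
    \sum_(K : {set 'I_n}) qprod (Jm m) K * F w K.
  elim: m => [_|m IH mn].
    exists z'; split; first by apply/rowP => l; rewrite mxE.
    by [].
  have [w [ew ->]] := IH (ltnW mn).
  have Dw : D (zm m) by rewrite -ew; exact: set_mem (valP w).
  have [DS ol] := zmS m (Ordinal mn) erefl Dw.
  exists (exist _ (zm m.+1) (mem_set DS)); split => //.
  apply: (circ_pt_flip (h := Ordinal mn)) => //=.
    by rewrite !ew !ptm.
  by move=> l /ol[a b]; rewrite ew a b.
have [w [ew ->]] := main n (leqnn n).
have -> : w = z by apply: val_inj; apply/rowP => l; rewrite ew mxE ltn_ord.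
apply: eq_bigr => K _; congr (_ * _); apply: eq_bigr => k _.
by rewrite /Jm ltn_ord.
Qed.

Definition slice (R : realType) (n : nat) (D : set 'rV[R[i]]_n) :
    set (circ D -> quat R) :=
  @slice_of R n D @` stem D.
Arguments slice {R n} D.

Definition conj_invariant1 (R : realType) (E : set R[i]) :=
  forall w, E w <-> E (conjc w).

Definition circ1 (R : realType) (E : set R[i]) : set (quat R) :=
  [set q | exists w J, [/\ E w, imag_units J & q = qpt w J]].

(* The set E is determined by circ1 E when it is invariant. *)
Definition slice1 (R : realType) (W : set (quat R)) (g : W -> quat R) : Prop :=
  exists E : set R[i], [/\ conj_invariant1 E, W = circ1 E &
    exists G1 G2 : E -> quat R,
      (forall v w : E, val w = conjc (val v) ->
         G1 w = G1 v /\ G2 w = - G2 v) /\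
      (forall (w : E) (J : quat R) (x : W), imag_units J ->
         val x = qpt (val w) J -> g x = G1 w + J * G2 w)].

Definition upd (R : realType) (n : nat) (h : 'I_n) (y : 'rV[quat R]_n)
    (x : quat R) : 'rV[quat R]_n :=
  \row_l (if l == h then x else y 0 l).

Definition section (R : realType) (n : nat) (D : set 'rV[R[i]]_n) (h : 'I_n)
    (y : 'rV[quat R]_n) : set (quat R) :=
  [set x | circ D (upd h y x)].

Lemma upd_in (R : realType) (n : nat) (D : set 'rV[R[i]]_n) (h : 'I_n)
  (y : 'rV[quat R]_n) (x : section D h y) : upd h y (val x) \in circ D.
Proof. exact: mem_set (set_mem (valP x)). Qed.

Definition restr (R : realType) (n : nat) (D : set 'rV[R[i]]_n)
    (f : circ D -> quat R) (h : 'I_n) (y : 'rV[quat R]_n) :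
    section D h y -> quat R :=
  fun x => f (exist _ (upd h y (val x)) (upd_in x)).

(* The sphere S_q; \alpha and \beta are determined by q up to the sign of
   \beta. *)
Definition sphere (R : realType) (q : quat R) : set (quat R) :=
  [set x | exists w J I, [/\ imag_units J, imag_units I,
     q = qpt w J & x = qpt w I]].

Lemma imag_unitsN (R : realType) (J : quat R) :
  imag_units J -> imag_units (- J).
Proof. by rewrite /imag_units /= sqrrN. Qed.

Lemma qptC (R : realType) (w : R[i]) (J : quat R) :
  qpt (conjc w) J = qpt w (- J).
Proof. by case: w => a b; rewrite /qpt /= scaleNr mulrN mulNr. Qed.

Lemma sphere_section (R : realType) (n : nat) (D : set 'rV[R[i]]_n)
    (h : 'I_n) (y : 'rV[quat R]_n) :
  conj_invariant D -> circ D y -> sphere (y 0 h) `<=` section D h y.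
Proof.
move=> Di [[z J] /= [Ju ->]] x [w [J1 [I [J1u Iu]]]].
rewrite mxE => e ->; rewrite /section /circ /=.
have [I' [I'u ->]] : exists I', imag_units I' /\ qpt w I = qpt (val z 0 h) I'.
  have [[-> _]|[-> _]|[-> _]] := qpt_inj (Ju h) J1u e; try by exists I.
  by exists (- I); rewrite qptC; split=> //; exact: imag_unitsN.
exists (z, fun l => if l == h then I' else J l) => /=; split.
  by move=> l; case: ifP.
by apply/rowP => l; rewrite !mxE; case: eqP => // ->.
Qed.

Definition slice_in (R : realType) (n : nat) (D : set 'rV[R[i]]_n) (h : 'I_n) :
    set (circ D -> quat R) :=
  [set f | slice D f /\ forall y, circ D y -> slice1 (restr f (h := h) (y := y))].
Arguments slice_in {R n} D h.

(* By sphere_section the whole sphere lies in the domain of restr f. *)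
Definition circular_in (R : realType) (n : nat) (D : set 'rV[R[i]]_n)
    (h : 'I_n) : set (circ D -> quat R) :=
  [set f | slice D f /\ forall y, circ D y ->
     forall x x' : section D h y, sphere (y 0 h) (val x) ->
       sphere (y 0 h) (val x') -> restr f x = restr f x'].
Arguments circular_in {R n} D h.

Definition slice_on (R : realType) (n : nat) (D : set 'rV[R[i]]_n)
    (H : {set 'I_n}) : set (circ D -> quat R) :=
  slice D `&` \bigcap_(h in [set` H]) slice_in D h.
Arguments slice_on {R n} D H.

Definition circular_on (R : realType) (n : nat) (D : set 'rV[R[i]]_n)
    (H : {set 'I_n}) : set (circ D -> quat R) :=
  slice D `&` \bigcap_(h in [set` H]) circular_in D h.
Arguments circular_on {R n} D H.

(* Main.v *)
Require Import Defs.
From mathcomp Require Import all_boot all_order all_algebra.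
From mathcomp Require Import boolp classical_sets reals.
From mathcomp Require Import complex.

(** A slice function is circular in [x_h] exactly when it is induced by a stem
    function without components [F_K], [h \in K].

    If no such component occurs, the defining sum never involves [J_h], so
    moving [J_h] over the unit sphere does not change the value
    ([stem_free_circular]).  Conversely, replacing [z] by its conjugate in the
    [h]-th coordinate, with the units [J] kept, moves the point along its
    [h]-th sphere and changes the sign of exactly the terms with [h \in K].
    Circularity makes the two values equal, hence the sum of those terms is
    zero at every point, and deleting the components [F_K], [h \in K], from [F]
    does not change the induced function ([slice_of_drop]).  Deleting in turn
    for every [h \in H] yields the required stem function
    ([circular_stem_free]).

    The inclusion into the functions that are slice in [x_h] comes straight
    from circularity ([circular_in_slice1]): a function that is constant on
    spheres is the one-variable slice function with [G_2 = 0]. *)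

Import GRing.Theory Num.Theory.

Local Open Scope classical_set_scope.
Local Open Scope ring_scope.

Set Implicit Arguments.
Unset Strict Implicit.

(** A quaternion has two representations [qpt w J], or a whole sphere of them
    when it is real; the sphere through it can be read off from any one. *)
Lemma sphere_qpt (R : realType) (w : R[i]) (J x : quat R) :
  imag_units J ->
  sphere (qpt w J) x <-> exists2 I, imag_units I & x = qpt w I.
Proof.
move=> Ju; split=> [[w' [J' [I [J'u Iu e ->]]]]|[I Iu ->]]; last first.
  by exists w, J, I.
case: (qpt_inj Ju J'u e) => [[<- _]|[-> _]|[<- _]]; try by exists I.
by exists (- I); [exact: imag_unitsN|rewrite qptC].
Qed.

Lemma circ_pt_in (R : realType) (n : nat) (D : set 'rV[R[i]]_n) (z : D)
    (J : 'I_n -> quat R) :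
  (forall l, imag_units (J l)) -> circ_pt (val z) J \in circ D.
Proof. by move=> Ju; apply: mem_set; exists (z, J). Qed.

Lemma circ_coord (R : realType) (n : nat) (D : set 'rV[R[i]]_n)
    (u : 'rV[quat R]_n) (h : 'I_n) :
  circ D u -> exists w J, imag_units J /\ u 0 h = qpt w J.
Proof.
by move=> [[z J] /= [Ju ->]]; exists (val z 0 h), (J h); rewrite mxE.
Qed.

(** Circularity compares values along one-variable sections; stated between
    points of the circular set it no longer involves dependent types. *)
Lemma circular_inP (R : realType) (n : nat) (D : set 'rV[R[i]]_n) (h : 'I_n)
    (f : circ D -> quat R) :
  circular_in D h f <->
  slice D f /\ forall u v : circ D,
    (forall l, l != h -> val u 0 l = val v 0 l) ->
    sphere (val u 0 h) (val v 0 h) -> f u = f v.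
Proof.
split=> -[fs fc]; split=> //.
  move=> u v uv suv.
  have updE (x : circ D) : (forall l, l != h -> val u 0 l = val x 0 l) ->
      upd h (val u) (val x 0 h) = val x.
    move=> ux; apply/rowP => l; rewrite mxE.
    by have [->//|/ux] := eqVneq l h.
  have Du : circ D (val u) := set_mem (valP u).
  have inS (x : circ D) : (forall l, l != h -> val u 0 l = val x 0 l) ->
      val x 0 h \in section D h (val u).
    move=> ux; apply: mem_set; rewrite /section /= updE //.
    exact: set_mem (valP x).
  have su : sphere (val u 0 h) (val u 0 h).
    have [w [J [Ju ->]]] := circ_coord h Du.
    by apply/sphere_qpt => //; exists J.
  pose xu : section D h (val u) := 
    exist _ (val u 0 h) (inS u (fun _ _ => erefl)).
  pose xv : section D h (val u) := exist _ (val v 0 h) (inS v uv).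
  have := fc _ Du xu xv su suv.
  rewrite /restr; congr (f _ = f _); apply: val_inj; exact: updE.
move=> y Dy x x' sx sx'; apply: fc => [l /negbTE lh|] /=.
  by rewrite !mxE lh.
rewrite !mxE eqxx.
have [w [J [Ju yE]]] := circ_coord h Dy.
move: sx sx'; rewrite yE => /(sphere_qpt _ _ Ju)[I Iu ->].
by move=> /(sphere_qpt _ _ Ju)[I' I'u ->]; apply/sphere_qpt => //; exists I'.
Qed.

Definition stem_free (R : realType) (n : nat) (D : set 'rV[R[i]]_n)
    (A : {pred 'I_n}) (F : D -> tens R n) : Prop :=
  forall z (K : {set 'I_n}) h, h \in A -> h \in K -> F z K = 0.

Lemma stem_freeP (R : realType) (n : nat) (D : set 'rV[R[i]]_n)
    (H : {set 'I_n}) (F : D -> tens R n) :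
  stem_free [in H] F <->
  forall z, F z = \sum_(K : {set 'I_n} | K \subset ~: H) e_ K (F z K).
Proof.
split=> [FH z|FE z K h hH hK].
  rewrite [LHS]tens_sum [RHS]big_mkcond /=; apply: eq_bigr => K _.
  case: ifPn => // /subsetPn[h hK]; rewrite finset.in_setC negbK => hH.
  by rewrite (FH z K h) //; apply/ffunP => L; rewrite !ffunE if_same.
rewrite FE sum_ffunE big1 // => L /fintype.subsetP LH; rewrite ffunE.
case: eqP => // KL; have := LH h.
by rewrite -KL hK finset.in_setC hH => /(_ isT).
Qed.

(** The units [J_h] at two points of the same [h]-th sphere differ, but a
    product over [K] with [h \notin K] does not contain [J_h]. *)
Lemma stem_free_circular (R : realType) (n : nat) (D : set 'rV[R[i]]_n)
    (D_conj : conj_invariant D) (h : 'I_n) (F : D -> tens R n) :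
  stem D F -> (forall z (K : {set 'I_n}), h \in K -> F z K = 0) ->
  circular_in D h (slice_of F).
Proof.
move=> Fs F0; apply/circular_inP; split; first by exists F.
move=> u v uv; have [[z J] [Ju uE]] := circ_repr u.
rewrite {1}uE mxE => /(sphere_qpt _ _ (Ju h))[I Iu vh].
pose J' l := if l == h then I else J l.
have J'u l : imag_units (J' l) by rewrite /J'; case: eqP.
have vE : val v = circ_pt (val z) J'.
  apply/rowP => l; rewrite mxE /J'; case: eqP => [->//|/eqP lh].
  by rewrite -uv // uE mxE.
rewrite (slice_ofE D_conj Fs Ju uE) (slice_ofE D_conj Fs J'u vE).
apply: eq_bigr => K _.
have [/F0->|hK] := boolP (h \in K); first by rewrite !mulr0.
congr (_ * _); apply: eq_bigr => k kK; rewrite /J'.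
by case: eqP kK hK => // -> ->.
Qed.

Definition stem_drop (R : realType) (n : nat) (D : set 'rV[R[i]]_n)
    (h : 'I_n) (F : D -> tens R n) : D -> tens R n :=
  fun z => [ffun K : {set 'I_n} => if h \in K then 0 else F z K].

Lemma stem_drop_stem (R : realType) (n : nat) (D : set 'rV[R[i]]_n)
    (h : 'I_n) (F : D -> tens R n) :
  stem D F -> stem D (stem_drop h F).
Proof.
move=> Fs K k z w e; rewrite !ffunE; case: ifP => _; first by rewrite mulr0.
exact: Fs.
Qed.

(** Compare the value at [z] with the value at [conj_at h z] for the same units:
    by the parity of the stem function they are [S + T] and [- S + T], where [S]
    collects the terms with [h \in K]; circularity forces [S = 0].  Conjugating
    [z] instead of negating [J h] leaves the products of units alone, so
    nothing has to be moved across a noncommutative product. *)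
Lemma slice_of_drop (R : realType) (n : nat) (D : set 'rV[R[i]]_n)
    (D_conj : conj_invariant D) (h : 'I_n) (F : D -> tens R n) :
  stem D F -> circular_in D h (slice_of F) ->
  slice_of (stem_drop h F) = slice_of F.
Proof.
move=> Fs /circular_inP[_ fc]; apply/funext => u.
have [[z J] [Ju uE]] := circ_repr u.
have Dz' : conj_at h (val z) \in D.
  by apply: mem_set; exact: (D_conj h _).1 (set_mem (valP z)).
pose z' : D := exist _ (conj_at h (val z)) Dz'.
pose v : circ D := exist _ (circ_pt (val z') J) (circ_pt_in z' Ju).
have vE : val v = circ_pt (val z') J by [].
(* v is u with J_h replaced by - J_h *)
have fuv : slice_of F u = slice_of F v.
  apply: fc => [l /negbTE lh|]; rewrite vE uE !mxE ?lh ?eqxx //.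
  by apply/sphere_qpt => //; exists (- J h); [exact: imag_unitsN|rewrite qptC].
have FuE := slice_ofE D_conj Fs Ju uE.
have S0 : \sum_(K : {set 'I_n} | h \in K) qprod J K * F z K = 0.
  move: fuv; rewrite FuE (slice_ofE D_conj Fs Ju vE).
  rewrite (bigID (fun K : {set 'I_n} => h \in K)) /=.
  rewrite [X in _ = X](bigID (fun K : {set 'I_n} => h \in K)) /=.
  rewrite [X in _ = X + _](_ : _ =
      - \sum_(K : {set 'I_n} | h \in K) qprod J K * F z K); last first.
    rewrite -sumrN; apply: eq_bigr => K hK.
    rewrite (Fs K h z z') // (finset.setIidPr _) ?finset.sub1set //.
    by rewrite cards1 expr1 mulN1r mulrN.
  rewrite [X in _ = _ + X](eq_bigr (fun K => qprod J K * F z K)); last first.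
    move=> K hK; rewrite (Fs K h z z') //.
    suff -> : K :&: [set h]%SET = finset.set0 by rewrite cards0 expr0 mul1r.
    by apply/eqP; rewrite finset.setI_eq0 disjoint_sym disjoints1.
  set S := \sum_(K | _) _ => /addIr SN.
  have : (2 : R) *: S = 0 by rewrite scaler_nat mulr2n {1}SN addNr.
  by move/eqP; rewrite scaler_eq0 pnatr_eq0 => /eqP.
rewrite (slice_ofE D_conj (stem_drop_stem h Fs) Ju uE) FuE.
rewrite [RHS](bigID (fun K : {set 'I_n} => h \in K)) /= S0 add0r.
rewrite [RHS]big_mkcond; apply: eq_bigr => K _; rewrite ffunE.
by case: ifP; rewrite ?mulr0.
Qed.

(** Deleting the components of index [K] containing one element of [A] after
    the other keeps the earlier components at [0] and the induced function
    unchanged, so circularity in the next variable is still available. *)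
Lemma circular_stem_free (R : realType) (n : nat) (D : set 'rV[R[i]]_n)
    (D_conj : conj_invariant D) (f : circ D -> quat R) (A : seq 'I_n) :
  slice D f -> (forall h, h \in A -> circular_in D h f) ->
  exists F : D -> tens R n,
    [/\ stem D F, stem_free [in A] F & slice_of F = f].
Proof.
move=> fs; elim: A => [_|a A IH fc]; first by have [F Fs <-] := fs; exists F.
have [h hA|F [Fs F0 Ff]] := IH; first by apply: fc; rewrite inE hA orbT.
exists (stem_drop a F); split; first exact: stem_drop_stem.
- move=> z K h; rewrite ffunE !inE => /orP[/eqP->->//|hA hK].
  by rewrite (F0 z K h) // if_same.
- by rewrite slice_of_drop // Ff; apply: fc; rewrite mem_head.
Qed.

(** A section of a function circular in [x_h] has the form [G_1 + J G_2] with
    [G_2 = 0] and [G_1 w] its value at any point of the sphere of [w]. *)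
Lemma circular_in_slice1 (R : realType) (n : nat) (D : set 'rV[R[i]]_n)
    (D_conj : conj_invariant D) (h : 'I_n) (f : circ D -> quat R) :
  circular_in D h f ->
  forall y, circ D y -> slice1 (restr f (h := h) (y := y)).
Proof.
move=> /circular_inP[_ fc] y Dy.
have updK q q' : upd h (upd h y q) q' = upd h y q'.
  by apply/rowP => l; rewrite !mxE; case: eqP.
have sec_sphere w J I : imag_units J -> imag_units I ->
    section D h y (qpt w J) -> section D h y (qpt w I).
  move=> Ju Iu Dw; rewrite /section /= -(updK (qpt w J)).
  apply: (sphere_section D_conj Dw); rewrite mxE eqxx.
  by apply/sphere_qpt => //; exists I.
(* an arbitrary unit, at which G_1 evaluates the section *)
have [J0 J0u] : exists J, imag_units (R := R) J.
  by have [[z J] /= [Ju _]] := Dy; exists (J h).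
pose E : set R[i] := [set w | section D h y (qpt w J0)].
exists E; split.
- move=> w; rewrite /E /= qptC; split; apply: sec_sphere => //;
    exact: imag_unitsN.
- apply/seteqP; split=> [x Dx|x [w [J [Ew Ju ->]]]]; last first.
    exact: sec_sphere Ew.
  have [w [J [Ju]]] := circ_coord h Dx; rewrite mxE eqxx => xE.
  exists w, J; split=> //; rewrite /E /=; apply: (sec_sphere _ J) => //.
  by rewrite -xE.
have inS (w : E) : qpt (val w) J0 \in section D h y.
  by apply: mem_set; exact: (set_mem (valP w)).
have restr_sphere (x x' : section D h y) :
    sphere (val x) (val x') -> restr f x = restr f x'.
  move=> s; apply: fc => [l /negbTE lh|]; rewrite !mxE ?lh ?eqxx //.
pose pt (w : E) : section D h y := exist _ (qpt (val w) J0) (inS w).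
exists (fun w => restr f (pt w)), (fun=> 0).
split=> [v w vw|w J x Ju xE]; rewrite ?oppr0 ?mulr0 ?addr0.
  split=> //; apply: restr_sphere; rewrite /= vw qptC.
  by apply/sphere_qpt; [exact: imag_unitsN|exists J0].
by apply: restr_sphere; rewrite xE; apply/sphere_qpt => //; exists J0.
Qed.

Theorem proposition3p4 (R : realType) (n : nat) (n_gt0 : (0 < n)%N)
    (D : set 'rV[R[i]]_n) (D_conj : conj_invariant D) :
  (forall H : {set 'I_n},
     circular_on D H =
     [set slice_of F | F in [set F : D -> tens R n | stem D F /\
        forall z : D, F z = \sum_(K : {set 'I_n} | K \subset ~: H) e_ K (F z K)]]) /\
  (forall H : {set 'I_n}, circular_on D H `<=` slice_on D H).
Proof.
split=> H; last first.
  move=> f [fs fc]; split=> // h hH; split=> //.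
  exact: circular_in_slice1 (fc h hH).
apply/seteqP; split=> [f [fs fc]|_ [F [Fs /stem_freeP F0] <-]].
  have [|F [Fs F0 Ff]] := circular_stem_free D_conj (A := enum H) fs.
    by move=> h; rewrite mem_enum; exact: fc.
  exists F => //; split=> //; apply/stem_freeP => z K h hH.
  by apply: F0; rewrite mem_enum.
split; first by exists F.
by move=> h hH; apply: stem_free_circular => // z K; exact: F0.
Qed.
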